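(* $\pi_{5.4}(\emptyset)=\pi_{5.6}(\emptyset)=\dfrac{20}{27}$.
   Context: A $3$-graph is a pair $G=(V,E)$ with $E$ a set of $3$-element subsets of $V$. For integers $m,k$, $m.k$ denotes the family of all $3$-graphs on $m$ vertices with exactly $k$ edges. For a $3$-graph $G$ on $n\ge m$ vertices, $e_{m.k}(G)$ is the number of $m$-element subsets of $V(G)$ spanning exactly $k$ edges of $G$, and $\pi_{m.k}(\emptyset)=\lim_{n\to\infty}\max\{e_{m.k}(G): |V(G)|=n\}/\binom{n}{m}$ (the limit exists). *)

(* Defs.v *)
From HB Require Import structures.
From mathcomp Require Import all_boot all_order all_algebra.
From mathcomp Require Import all_classical all_reals all_analysis.

Set Implicit Arguments.
Unset Strict Implicit.
Unset Printing Implicit Defensive.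

Import Order.TTheory GRing.Theory Num.Theory.
Import numFieldNormedType.Exports.

Local Open Scope classical_set_scope.
Local Open Scope ring_scope.

(* A 3-graph with vertex set V is given by its edge set E. *)
Definition is_3graph (V : finType) (E : {set {set V}}) : bool :=
  [forall e in E, #|e| == 3%N].

(* [E ::&: S] is the set of edges of E contained in S. *)
Definition e_mk (V : finType) (m k : nat) (E : {set {set V}}) : nat :=
  #|[set S : {set V} | (#|S| == m) && (#|E ::&: S| == k)]|%SET.

Definition max_e_mk (m k n : nat) : nat :=
  (\max_(E : {set {set 'I_n}} | is_3graph E) e_mk m k E)%N.

(* For n < m the denominator is 0 and the value is the irrelevant 0. *)
Definition density_mk (R : realType) (m k : nat) : R^nat :=
  fun n => (max_e_mk m k n)%:R / ('C(n, m))%:R.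

(* [lim] is total with default value 0 on divergent sequences (see
   pi_mk_neq0_cvg), so a nonzero value of pi_mk is a genuine limit. *)
Definition pi_mk (R : realType) (m k : nat) : R :=
  lim (density_mk R m k @ \oo).

Lemma pi_mk_neq0_cvg (R : realType) (m k : nat) :
  pi_mk R m k != 0 -> density_mk R m k @ \oo --> pi_mk R m k.
Proof.
move=> h; case: (pselect (cvg (density_mk R m k @ \oo))) => // ncv.
by move: h; rewrite /pi_mk (dvgP ncv) eqxx.
Qed.

(* Main.v *)
Require Import Defs.
From Stdlib Require Import ZArith.
From mathcomp Require Import all_boot all_order all_algebra.
From mathcomp Require Import all_classical all_reals all_analysis.
From mathcomp Require Import fintype finset zify ssrZ ring lra.

(** The lower bound comes from colouring the vertices by residues modulo 3 and
    taking as edges the triples with colour sum 0: a 5-set spans exactly 4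
    edges as soon as its colour classes have sizes (4,1,0), (3,1,1) or (2,2,1),
    which happens with limiting probability 20/27.  Taking complements
    exchanges 4 and 6 among the 10 triples of a 5-set.

    The upper bound is a flag algebra argument on 6 vertices.  For a graph [g]
    on 6 vertices, [slack g] is a positive multiple of [20/27 - d(g)], with
    [d(g)] the proportion of 5-sets spanning 4 edges, minus quadratic forms
    evaluated at pairs of flags that share their roots and partition the other
    vertices.  One checks that [slack] is nonnegative on every [g].  Summing
    over all maps [x] from the 6 vertices to [V], injective or not (a triple
    with repeated vertices is no edge), turns the quadratic forms into sums of
    squares, and [#|V|^6 * 20/27] is seen to dominate the sum of [d], with no
    error term. *)

Set Implicit Arguments.
Unset Strict Implicit.
Unset Printing Implicit Defensive.

Import Order.TTheory GRing.Theory Num.Theory.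
Import numFieldNormedType.Exports.

Local Open Scope ring_scope.

(** * The numerical certificate *)

(* A pair [(d, L)] stands for the square [d * (sum over flags f of L f)^2].
   [squares1] and [squares2] belong to 4 roots a, b, c, d spanning only abc,
   resp. only abc and abd; a flag adds one vertex u, and L is indexed by the
   binary code of the edge bits abu, acu, adu, bcu, bdu, cdu (most significant
   first).  [squares0] belongs to 2 roots a, b; a flag adds u and v, and L is
   indexed by 3 (abu + abv) + (auv + buv).  The vectors are rounded eigenvectors
   of a numerical solution of the semidefinite program; the multipliers are a
   lattice point making [slack] vanish on all 6-vertex subgraphs of the
   colouring construction. *)
Section Certificate.
Local Open Scope Z_scope.

Definition squares1 : seq (Z * seq Z) :=
  [:: (36250, [:: 0; -1; 1; 0; 0; -3; 3; 0; 0; 1; -1; 0; 0; -5; 5; 0; -2; -9;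
        1; -6; 0; -1; -1; -5; -6; -3; -1; 0; -3; -6; 6; 0; 2; -1; 9; 6; 0; 1;
        1; 5; 6; 1; 3; 0; 3; -6; 6; 0; 0; -2; 2; 0; 0; 0; 0; 0; 0; -1; 1; 0; 0;
        2; -2; 0]);
      (16049, [:: 0; 0; 0; 0; 0; -9; 9; 0; 0; 0; 0; 0; 0; -3; 3; 0; 5; -3; 1;
        0; -1; 3; 1; 3; 6; -2; 3; 7; 1; 4; 2; -2; -5; -1; 3; 0; 1; -1; -3; -3;
        -6; -3; 2; -7; -1; -2; -4; 2; 0; 0; 0; 0; 0; -7; 7; 0; 0; 1; -1; 0; 0;
        2; -2; 0]);
      (9050, [:: 0; -2; 2; 0; 0; 6; -6; 0; 0; -7; 7; 0; 0; -8; 8; 0; -7; 2; 3;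
        -2; -5; 3; 2; 9; -4; 2; 6; 8; -1; 0; 1; 0; 7; -3; -2; 2; 5; -2; -3; -9;
        4; -6; -2; -8; 1; -1; 0; 0; 0; -3; 3; 0; 0; -1; 1; 0; 0; -9; 9; 0; 0;
        -7; 7; 0]);
      (3429, [:: 0; 0; 0; 0; 0; 7; -7; 0; 0; 0; 0; 0; 0; 9; -9; 0; 0; -7; 0;
        -9; 0; 0; 0; 7; 7; 0; 9; 0; 0; -7; 0; 0; 0; 0; 7; 9; 0; 0; 0; -7; -7;
        -9; 0; 0; 0; 0; 7; 0; 0; 0; 0; 0; 0; 0; 0; 0; 0; 7; -7; 0; 0; 0; 0;
        0]);
      (4900, [:: -7; -1; -1; 0; -8; 1; 1; -5; -1; 0; 0; 10; -4; 4; 4; 7; -8; 1;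
        -4; 4; -9; 3; -1; -1; 1; -5; 4; 7; -1; -1; 16; -1; -8; -4; 1; 4; -9;
        -1; 3; -1; 1; 4; -5; 7; -1; 16; -1; -1; -9; -1; -1; 16; -3; -2; -2; 0;
        3; -1; -1; -1; -2; 0; 0; 10]);
      (4322, [:: 5; -4; -4; -5; 2; -5; -5; -1; -4; -5; -5; -8; 1; -1; -1; -11;
        2; -5; 1; -1; 4; 3; 1; 2; -5; -1; -1; -11; 1; 2; -8; -3; 2; 1; -5; -1;
        4; 1; 3; 2; -5; -1; -1; -11; 1; -8; 2; -3; 4; 1; 1; -8; 3; 1; 1; 14; 3;
        2; 2; -3; 1; 14; 14; -11]);
      (7953, [:: 5; 0; 0; -1; 4; -1; -1; 2; 0; -1; -1; -7; 2; -2; -2; -6; 4;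
        -1; 2; -2; 5; -1; 1; 4; -1; 2; -2; -6; 1; 4; -9; -17; 4; 2; -1; -2; 5;
        1; -1; 4; -1; -2; 2; -6; 1; -9; 4; -17; 5; 1; 1; -9; 2; 0; 0; 3; -1; 4;
        4; -17; 0; 3; 3; -7])].

Definition squares2 : seq (Z * seq Z) :=
  [:: (38422, [:: 0; 0; 2; -2; 2; -2; -3; -9; -2; 2; 0; 0; 0; 0; -5; -3; -2; 2;
        0; 0; 0; 0; -5; -3; 3; 9; 5; 3; 5; 3; 0; 0; 0; 0; 1; -5; 1; -5; 1; -6;
        -1; 5; 0; 0; 0; 0; -6; -1; -1; 5; 0; 0; 0; 0; -6; -1; -1; 6; 6; 1; 6;
        1; 0; 0]);
      (10917, [:: 0; 0; -1; -9; -1; -9; -1; 2; 1; 9; 0; 0; 0; 0; -5; 4; 1; 9;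
        0; 0; 0; 0; -5; 4; 1; -2; 5; -4; 5; -4; 0; 0; 0; 0; -4; 5; -4; 5; -8;
        -4; 4; -5; 0; 0; 0; 0; 0; -8; 4; -5; 0; 0; 0; 0; 0; -8; 8; 4; 0; 8; 0;
        8; 0; 0])].

Definition squares0 : seq (Z * seq Z) :=
  [:: (16425, [:: -2; -3; 9; -4; 3; 0; -2; 1; 2]);
      (8535, [:: 8; -5; -3; -4; 1; 8; -10; 9; 6]);
      (780, [:: -7; 1; -9; 13; 0; 3; 12; 6; -20])].

End Certificate.

(** * Patterns and their placements in six vertices *)

(* Colexicographic order, so that [take 10 triples] are the triples of the
   first five vertices. *)
Definition triples : seq (seq nat) :=
  [seq [:: abc.1.1; abc.1.2; abc.2] |
     abc <- [seq (ab, c) | c <- iota 0 6,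
               ab <- [seq (a, b) | b <- iota 0 c, a <- iota 0 b]]].

Definition triple_index (t : seq nat) : nat :=
  find [pred s | perm_eq s t] triples.

Fixpoint arrangements (k : nat) (s : seq nat) : seq (seq nat) :=
  if k is k'.+1 then
    [seq x :: r | x <- s, r <- arrangements k' (rem x s)]
  else [:: [::]].

Definition vertex_orders : seq (seq nat) := arrangements 6 (iota 0 6).

Definition pattern5 : seq (seq nat) := take 10 triples.

Definition pattern4 : seq (seq nat) :=
  [:: [:: 0; 1; 2]; [:: 0; 1; 3]; [:: 0; 2; 3]; [:: 1; 2; 3];
      [:: 0; 1; 4]; [:: 0; 2; 4]; [:: 0; 3; 4];
      [:: 1; 2; 4]; [:: 1; 3; 4]; [:: 2; 3; 4];
      [:: 0; 1; 5]; [:: 0; 2; 5]; [:: 0; 3; 5];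
      [:: 1; 2; 5]; [:: 1; 3; 5]; [:: 2; 3; 5]]%N.

Definition pattern2 : seq (seq nat) :=
  [:: [:: 0; 1; 2]; [:: 0; 1; 3]; [:: 0; 2; 3]; [:: 1; 2; 3];
      [:: 0; 1; 4]; [:: 0; 1; 5]; [:: 0; 4; 5]; [:: 1; 4; 5]]%N.

Definition positions (pat : seq (seq nat)) (o : seq nat) : seq nat :=
  [seq triple_index [seq nth 0%N o i | i <- t] | t <- pat].

(* One vertex order for each placement of a pattern, up to the symmetries of the
   weight attached to it. *)
Definition orders5 : seq (seq nat) :=
  [seq o <- vertex_orders | sorted ltn (take 5 o)].
Definition orders4 : seq (seq nat) :=
  [seq o <- vertex_orders | (nth 0 o 4 < nth 0 o 5)%N].
Definition orders2 : seq (seq nat) :=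
  [seq o <- vertex_orders | [&& nth 0 o 0 < nth 0 o 1, nth 0 o 2 < nth 0 o 3,
     nth 0 o 4 < nth 0 o 5 & nth 0 o 2 < nth 0 o 4]]%N.

Definition read (g : seq bool) (p : seq nat) : seq bool :=
  [seq nth false g i | i <- p].

Fixpoint code (b : seq bool) : nat :=
  if b is x :: b' then ((if x then 2 ^ size b' else 0) + code b')%N else 0%N.

(** * Weights of placements and the slack of a graph *)

Section Weights.
Local Open Scope Z_scope.

Definition form (sq : seq (Z * seq Z)) (i j : nat) : Z :=
  foldr (fun s acc =>
    (s.1 * (nth 0 s.2 i * nth 0 s.2 j) + acc)) 0 sq.

Definition weight5 (b : seq bool) : Z :=
  if count id b == 4%N then 27 else 0.

Definition flag2 (b : seq bool) : nat :=
  (3 * count id (take 2 b) + count id (drop 2 b))%N.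

Definition weight4 (b : seq bool) : Z :=
  match b with
  | [:: true, false, false, false & f] =>
      form squares1 (code (take 6 f)) (code (drop 6 f))
  | [:: true, true, false, false & f] =>
      form squares2 (code (take 6 f)) (code (drop 6 f))
  | _ => 0
  end.

Definition weight2 (b : seq bool) : Z :=
  form squares0 (flag2 (take 4 b)) (flag2 (drop 4 b)).

Definition weight_sum (w : seq bool -> Z) (ps : seq (seq nat)) (g : seq bool) :
    Z :=
  foldr (fun p acc => (w (read g p) + acc)) 0 ps.

Definition scale : Z := 256860.

(** The placements are evaluated once here, so that the search does not recompute them for every
    graph. *)
Definition places5 : seq (seq nat) :=
  Eval vm_compute in map (positions pattern5) orders5.
Definition places4 : seq (seq nat) :=
  Eval vm_compute in map (positions pattern4) orders4.
Definition places2 : seq (seq nat) :=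
  Eval vm_compute in map (positions pattern2) orders2.

(** [weight5] gives 27 to each of the six 5-sets that spans 4 edges, and 120 = 6 * 27 * 20/27. *)
Definition slack (g : seq bool) : Z :=
  scale * (120 - weight_sum weight5 places5 g)
  - (weight_sum weight4 places4 g + weight_sum weight2 places2 g).

End Weights.

Lemma places5E : places5 = map (positions pattern5) orders5.
Proof. by vm_compute. Qed.

Lemma places4E : places4 = map (positions pattern4) orders4.
Proof. by vm_compute. Qed.

Lemma places2E : places2 = map (positions pattern2) orders2.
Proof. by vm_compute. Qed.

(** * Exhaustive search up to relabelling *)

Definition swap_at (k : nat) (o : seq nat) : seq nat :=
  [seq (if i == k then k.+1 else if i == k.+1 then k else i) | i <- o].

Fixpoint words (n : nat) : seq (seq nat) :=
  if n is m.+1 then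
    undup (words m ++ [seq swap_at k o | k <- iota 0 5, o <- words m])
  else [:: iota 0 6].

(* The action of short products of adjacent transpositions on the positions of
   the triples; few enough to be tested quickly, they reduce the 2^20 graphs to
   2984, against 2136 isomorphism classes. *)
Definition renamings : seq (seq nat) :=
  Eval vm_compute in map (positions triples) (words 3).

(* [drops p s p] implies that renaming by [s] makes every graph with prefix [p]
   lexicographically smaller. *)
Fixpoint drops (p : seq bool) (s : seq nat) (q : seq bool) : bool :=
  match s, q with
  | i :: s', b :: q' =>
      if onth p i is Some c then if b == c then drops p s' q' else b
      else false
  | _, _ => false
  end.

Fixpoint search (P : pred (seq bool)) (rs : seq (seq nat)) (k : nat)
    (p : seq bool) : bool :=
  if has (fun s => drops p s p) rs then true
  else if k is k'.+1 then
    search P rs k' (rcons p false) && search P rs k' (rcons p true)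
  else P p.

Lemma code_lt (b : seq bool) : (code b < 2 ^ size b)%N.
Proof.
elim: b => [|x b IHb] //=; rewrite expnS mul2n -addnn.
by case: x; rewrite ?ltn_add2l ?add0n ?(leq_trans IHb) ?leq_addr.
Qed.

Lemma size_read (g : seq bool) (p : seq nat) : size (read g p) = size p.
Proof. by rewrite size_map. Qed.

(** [code] puts the most significant bit first, so the first differing bit outweighs everything
    after it. *)
Lemma drops_code (p g : seq bool) (s : seq nat) (q r : seq bool) :
  (forall i c, onth p i = Some c -> nth false g i = c) ->
  size s = size (q ++ r) -> drops p s q ->
  (code (read g s) < code (q ++ r))%N.
Proof.
move=> pg; elim: s q => [|i s IHs] [|b q] //= [sz].
case Epi: (onth p i) => [c|] //; rewrite (pg _ _ Epi) size_read sz.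
case: eqP => [-> dr|/eqP bc bT]; first by rewrite ltn_add2l IHs.
rewrite bT in bc *; case: c bc {Epi} => // _; rewrite add0n.
by apply: (leq_trans (code_lt _)); rewrite size_read sz leq_addr.
Qed.

(** Descent on [code]: if a prefix is pruned, some renaming of [g] has a smaller code, so [P] holds
    there by induction and transfers back to [g]. This works even when [rs] leaves several graphs
    per isomorphism class. *)
Lemma search_sound (P : pred (seq bool)) (rs : seq (seq nat)) (n : nat) :
  {in rs, forall s, size s = n} ->
  {in rs, forall s g, size g = n -> P (read g s) -> P g} ->
  search P rs n [::] -> forall g, size g = n -> P g.
Proof.
move=> rsn rsP ok g; have [m] := ubnP (code g).
elim: m g => [|m IHm] g //; rewrite ltnS => gm gn.
have pruned p r s : s \in rs -> drops p s p -> g = p ++ r -> P g.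
  move=> rss dr gpr; apply: (rsP s) => //.
  apply: IHm; last by rewrite size_read rsn.
  apply: leq_trans gm; rewrite {2}gpr; apply: (drops_code (p := p)) => //.
    move=> i c ipc; have ip : (i < size p)%N by rewrite -onthTE ipc.
    by rewrite gpr nth_cat ip; apply: onth_nth ipc.
  by rewrite -gpr gn rsn.
suff H k p r : search P rs k p -> size r = k -> g = p ++ r -> P g.
  by apply: (H n [::] g).
elim: k p r => [|k IHk] p r /=; case: ifP => [/hasP[s rss dr] _ _|_].
- exact: (pruned p r s).
- by move=> Pp /size0nil -> ->; rewrite cats0.
- exact: (pruned p r s).
- case/andP => sf st; case: r => [|b r] // [rk] gpr.
  by apply: (IHk (rcons p b) r) => //; [case: (b) | rewrite cat_rcons].
Qed.

(** * Invariance of [slack] under relabelling *)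

(* Canonical representatives of placements under the symmetries of the weights;
   with them, invariance of [slack] is an equality of sorted lists. *)
Definition normal5 (p : seq nat) : seq nat := sort leq p.

Definition normal4 (p : seq nat) : seq nat :=
  if (nth 0 p 4 <= nth 0 p 10)%N then p
  else take 4 p ++ drop 10 p ++ take 6 (drop 4 p).

Definition normal2 (p : seq nat) : seq nat :=
  let u := sort leq (take 2 p) ++ sort leq (take 2 (drop 2 p)) in
  let v := sort leq (take 2 (drop 4 p)) ++ sort leq (drop 6 p) in
  if (nth 0 u 0 <= nth 0 v 0)%N then u ++ v else v ++ u.

Fixpoint lex_leq (p q : seq nat) : bool :=
  match p, q with
  | i :: p', j :: q' => if i == j then lex_leq p' q' else (i < j)%N
  | _, _ => true
  end.

Definition preserves (normal : seq nat -> seq nat) (ps : seq (seq nat))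
    (s : seq nat) : bool :=
  sort lex_leq [seq normal (map (nth 0%N s) p) | p <- ps] ==
  sort lex_leq (map normal ps).

Lemma weight_sumE (w : seq bool -> Z) (ps : seq (seq nat)) (g : seq bool) :
  weight_sum w ps g = \sum_(p <- ps) w (read g p).
Proof. by rewrite unlock /=; elim: ps => //= p ps ->. Qed.

Lemma read_read (g : seq bool) (s p : seq nat) :
  all (fun i => i < size s)%N p ->
  read (read g s) p = read g (map (nth 0%N s) p).
Proof.
move=> /allP ps; rewrite /read -map_comp; apply/eq_in_map => i /ps /= si.
by rewrite (nth_map 0%N).
Qed.

(** Renaming by [s] permutes the placements up to normal forms, which [w] does not distinguish. *)
Lemma weight_sum_renaming (w : seq bool -> Z) (normal : seq nat -> seq nat)
    (k : nat) (ps : seq (seq nat)) (s : seq nat) (g : seq bool) :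
  (forall p, size p = k -> w (read g (normal p)) = w (read g p)) ->
  all (fun p => (size p == k) && all (fun i => i < size s)%N p) ps ->
  preserves normal ps s -> weight_sum w ps (read g s) = weight_sum w ps g.
Proof.
move=> wn /allP psk /eqP ps_s; rewrite !weight_sumE.
transitivity (\sum_(q <- [seq normal (map (nth 0%N s) p) | p <- ps])
                w (read g q)).
  rewrite big_map; apply: eq_big_seq => p /psk /andP[/eqP pk ps'].
  by rewrite read_read // wn // size_map.
(* [sort] permutes its argument whatever the relation, so equal outputs make the two lists
   permutations of each other. *)
rewrite (perm_big (map normal ps)) /=; last first.
  by rewrite -(perm_sort lex_leq) ps_s perm_sort.
by rewrite big_map; apply: eq_big_seq => p /psk /andP[/eqP pk _]; rewrite wn.
Qed.

Lemma form_sym (sq : seq (Z * seq Z)) (i j : nat) : form sq i j = form sq j i.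
Proof. by elim: sq => //= s sq ->; rewrite (Z.mul_comm (nth _ _ i)). Qed.

Local Arguments form : simpl never.

Lemma perm_read (g : seq bool) (p q : seq nat) :
  perm_eq p q -> count id (read g p) = count id (read g q).
Proof. by move=> pq; apply/permP; apply: perm_map. Qed.

Lemma weight5_normal (g : seq bool) (p : seq nat) :
  weight5 (read g (normal5 p)) = weight5 (read g p).
Proof. by rewrite /weight5 (@perm_read _ _ p) // perm_sort. Qed.

Lemma weight4_normal (g : seq bool) (p : seq nat) : size p = 16%N ->
  weight4 (read g (normal4 p)) = weight4 (read g p).
Proof.
rewrite /normal4; case: ifP => // _.
case: p => [|a [|b [|c [|d p]]]] //; do 12 (case: p => // ? p).
case: p => //= _.
(* The root edges are common to both flags; in the two types that carry a form, swapping the flags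
   transposes its arguments. *)
rewrite /weight4; case: (nth false g a) => //; case: (nth false g b).
all: case: (nth false g c) => //; case: (nth false g d) => //=.
all: exact: form_sym.
Qed.

Lemma flag2_sort (g : seq bool) (p q : seq nat) : size p = 2%N ->
  flag2 (read g (sort leq p ++ sort leq q)) = flag2 (read g (p ++ q)).
Proof.
move=> p2; rewrite /flag2 /read !map_cat.
rewrite !take_size_cat ?drop_size_cat ?size_map ?size_sort //.
by rewrite -!/(read g _) !(@perm_read g (sort _ _) _ (permEl (perm_sort _ _))).
Qed.

Lemma weight2_cat (g : seq bool) (p q : seq nat) : size p = 4%N ->
  weight2 (read g (p ++ q)) =
  form squares0 (flag2 (read g p)) (flag2 (read g q)).
Proof.
move=> p4; rewrite /weight2 /read map_cat.
by rewrite take_size_cat ?drop_size_cat // size_map.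
Qed.

Lemma weight2_normal (g : seq bool) (p : seq nat) : size p = 8%N ->
  weight2 (read g (normal2 p)) = weight2 (read g p).
Proof.
case: p => [|a [|b [|c [|d p]]]] //; do 4 (case: p => // ? p); case: p => // _.
rewrite -[X in _ = weight2 (read g X)](cat_take_drop 4) [RHS]weight2_cat //.
rewrite /normal2; case: ifP => _.
all: rewrite weight2_cat; last by rewrite size_cat !size_sort.
all: by rewrite !flag2_sort //= form_sym.
Qed.

Lemma renamings_preserve :
  all (fun s => [&& size s == 20%N, preserves normal5 places5 s,
    preserves normal4 places4 s & preserves normal2 places2 s]) renamings.
Proof. by vm_compute. Qed.

Lemma slack_renaming (s : seq nat) (g : seq bool) :
  s \in renamings -> slack (read g s) = slack g.
Proof.
move=> /(allP renamings_preserve) /and4P[/eqP s20 pr5 pr4 pr2].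
rewrite /slack (weight_sum_renaming _ _ pr5 (k := 10)) => [||//] ; last first.
- by rewrite s20; vm_compute.
- by move=> p _; apply: weight5_normal.
rewrite (weight_sum_renaming (weight4_normal g) _ pr4) ?s20; last by vm_compute.
by rewrite (weight_sum_renaming (weight2_normal g) _ pr2) ?s20.
Qed.

Lemma slack_search : search (fun g => Z.leb 0 (slack g)) renamings 20 [::].
Proof. by vm_compute. Qed.

Lemma slack_ge0 (g : seq bool) : size g = 20%N -> 0 <= slack g.
Proof.
move: g; apply: search_sound slack_search => s rss.
  by have /and4P[/eqP] := allP renamings_preserve _ rss.
by move=> g _; rewrite slack_renaming.
Qed.

(** * Sums over tuples of vertices *)

Section TupleSums.
Variable V : finType.

Lemma sum_tuple0 (F : seq V -> Z) : \sum_(x : 0.-tuple V) F x = F [::].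
Proof.
rewrite (bigD1 [tuple]) //= big1 ?addr0 // => x.
by case/eqP; apply: val_inj; case: x => -[].
Qed.

Lemma sum_tupleS (n : nat) (F : seq V -> Z) :
  \sum_(x : n.+1.-tuple V) F x = \sum_a \sum_(x : n.-tuple V) F (a :: x).
Proof.
rewrite pair_big /=.
rewrite (reindex (fun ax : V * n.-tuple V => [tuple of ax.1 :: ax.2])) //=.
exists (fun x : n.+1.-tuple V => (thead x, [tuple of behead x])) => [[a x]|x] _.
  by congr pair; apply: val_inj.
by rewrite /= -tuple_eta.
Qed.

Lemma sum_tuple_reorder (n : nat) (v0 : V) (o : seq nat) (F : seq V -> Z) :
  perm_eq o (iota 0 n) ->
  \sum_(x : n.-tuple V) F (map (nth v0 x) o) = \sum_(x : n.-tuple V) F x.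
Proof.
move=> on; have so : size o == n by rewrite (perm_size on) size_iota.
pose f (x : n.-tuple V) := tcast (eqP so) (map_tuple (nth v0 x) (in_tuple o)).
have fE x : f x = map (nth v0 x) o :> seq V by rewrite val_tcast.
rewrite [RHS](reindex_inj (h := f)) => [|x y /(congr1 val)].
  by apply: eq_bigr => x _; rewrite fE.
rewrite /= !fE => /eq_in_map xy; apply: val_inj.
apply: (eq_from_nth (x0 := v0)); rewrite !size_tuple // => i ltin.
by apply: xy; rewrite (perm_mem on) mem_iota.
Qed.

End TupleSums.

(** * The upper bound: averaging over maps from six vertices to [V] *)

Definition view (V : finType) (E : {set {set V}}) (v0 : V)
    (pat : seq (seq nat)) (x : seq V) : seq bool :=
  [seq [set v in map (nth v0 x) t]%SET \in E | t <- pat].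

Arguments view : simpl never.

(** [positions] looks up triples regardless of the order of their entries, which is harmless because
    edges are sets. *)
Lemma read_view (V : finType) (E : {set {set V}}) (v0 : V) pat o x :
  all (fun i => i < 20)%N (positions pat o) ->
  all (all (fun i => i < size o)%N) pat ->
  read (view E v0 triples x) (positions pat o) =
  view E v0 pat (map (nth v0 x) o).
Proof.
move=> /allP idx /allP pat6; rewrite /read /view /positions -map_comp.
apply/eq_in_map => t pt; rewrite /comp.
have lt20 : (triple_index (map (nth 0%N o) t) < size triples)%N.
  exact: (idx _ (map_f _ pt)).
rewrite (nth_map [::] false _ lt20); congr (_ \in E).
apply/setP => v; rewrite !inE.
have /(nth_find [::]) /perm_mem tt :
  has [pred s | perm_eq s (map (nth 0%N o) t)] triples by rewrite has_find.
rewrite (eq_mem_map _ tt) -map_comp; congr (v \in _).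
apply/eq_in_map => i it /=.
by rewrite (nth_map 0%N) // (allP (pat6 t pt)).
Qed.

(** Each [s] in [sq] contributes [s.1] times the square of the sum of [nth 0 s.2 (c u)] over [u]. *)
Lemma form_psd (I : finType) (c : I -> nat) (sq : seq (Z * seq Z)) :
  all (fun s => Z.leb 0 s.1) sq ->
  0 <= \sum_u \sum_v form sq (c u) (c v).
Proof.
elim: sq => [|s sq IHsq] /=.
  by rewrite big1 // => u _; rewrite big1.
case/andP => s0 /IHsq sq0.
under eq_bigr do rewrite big_split /=; rewrite big_split /= addr_ge0 //.
rewrite (_ : \sum_u _ = s.1 * (\sum_u nth 0 s.2 (c u)) ^+ 2).
  by rewrite mulr_ge0 ?sqr_ge0.
rewrite expr2 mulr_suml mulr_sumr; apply: eq_bigr => u _.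
by rewrite mulr_sumr mulr_sumr.
Qed.

Definition reorders (pat os : seq (seq nat)) (k : nat) : bool :=
  [&& all (fun o => perm_eq o (iota 0 6)) os,
      all (all (fun i => i < 20)%N) (map (positions pat) os),
      all (all (fun i => i < 6)%N) pat & size os == k].

Lemma reorders5 : reorders pattern5 orders5 6.
Proof. by vm_compute. Qed.

Lemma reorders4 : reorders pattern4 orders4 360.
Proof. by vm_compute. Qed.

Lemma reorders2 : reorders pattern2 orders2 45.
Proof. by vm_compute. Qed.

(** Permuting coordinates preserves a sum over all tuples, so every order in [os] contributes the
    same amount. *)
Lemma weight_sum_view (V : finType) (E : {set {set V}}) (v0 : V) w pat os k :
  reorders pat os k ->
  \sum_(x : 6.-tuple V)
    weight_sum w (map (positions pat) os) (view E v0 triples x) =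
  (\sum_(x : 6.-tuple V) w (view E v0 pat x)) *+ k.
Proof.
case/and4P=> /allP os6; rewrite all_map => /allP os20 pat6 /eqP <-.
under eq_bigr do rewrite weight_sumE big_map.
rewrite exchange_big /=.
rewrite (eq_big_seq (fun=> \sum_(x : 6.-tuple V) w (view E v0 pat x))).
  by rewrite big_const_seq count_predT iter_addr_0.
move=> o oos; have o6 := os6 _ oos.
rewrite -(sum_tuple_reorder v0 (fun x => w (view E v0 pat x)) o6).
apply: eq_bigr => x _; rewrite read_view //; first exact: os20 oos.
by rewrite (perm_size o6) size_iota.
Qed.

(** Here [S5] is a sum over 5-tuples, whence the factor [n] for a free sixth vertex; 6, 360 and 45
    count the orders. The squares are dropped, then [K] and [6 n] are divided out. *)
Lemma cancel_squares (A : realDomainType) (K S5 S4 S2 : A) (n : nat) :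
  0 < K -> (0 < n)%N -> 0 <= S4 -> 0 <= S2 ->
  0 <= K * (120 *+ n ^ 6 - S5 *+ n *+ 6) - (S4 *+ 360 + S2 *+ 45) ->
  S5 <= 20 * n%:R ^+ 5.
Proof.
move=> K0 n0 S4_ge0 S2_ge0; rewrite subr_ge0 => S_ge0.
have : 0 <= K * (120 *+ n ^ 6 - S5 *+ n *+ 6).
  by apply: le_trans S_ge0; rewrite addr_ge0 // mulrn_wge0.
rewrite pmulr_rge0 // subr_ge0 -(mulr_natr 120) natrX exprSr.
rewrite (_ : 120 * _ = (20 * n%:R ^+ 5) *+ n *+ 6); last first.
  by rewrite -(mulr_natr _ n) -(mulr_natr _ 6); ring.
by rewrite ler_pMn2r // ler_pMn2r.
Qed.

Section SumsOfSquares.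
Variables (V : finType) (E : {set {set V}}) (v0 : V).

Lemma sum_5tuple (F : seq V -> Z) : \sum_(x : 5.-tuple V) F x =
  \sum_a \sum_b \sum_c \sum_d \sum_u F [:: a; b; c; d; u].
Proof.
rewrite sum_tupleS; apply: eq_bigr => a _.
rewrite (sum_tupleS _ (fun x => F (a :: x))); apply: eq_bigr => b _.
rewrite (sum_tupleS _ (fun x => F [:: a, b & x])); apply: eq_bigr => c _.
rewrite (sum_tupleS _ (fun x => F [:: a, b, c & x])); apply: eq_bigr => d _.
rewrite (sum_tupleS _ (fun x => F [:: a, b, c, d & x])); apply: eq_bigr => u _.
by rewrite (sum_tuple0 (fun x => F [:: a, b, c, d, u & x])).
Qed.

Lemma sum_6tuple (F : seq V -> Z) : \sum_(x : 6.-tuple V) F x =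
  \sum_a \sum_b \sum_c \sum_d \sum_u \sum_v F [:: a; b; c; d; u; v].
Proof.
rewrite sum_tupleS; apply: eq_bigr => a _.
by rewrite (sum_5tuple (fun x => F (a :: x))).
Qed.

Local Arguments code : simpl never.
Local Arguments form : simpl never.
Local Arguments weight_sum : simpl never.

Lemma sum_weight4_ge0 :
  0 <= \sum_(x : 6.-tuple V) weight4 (view E v0 pattern4 x).
Proof.
rewrite (sum_6tuple (fun x => weight4 (view E v0 pattern4 x))).
apply: sumr_ge0 => a _; apply: sumr_ge0 => b _.
apply: sumr_ge0 => c _; apply: sumr_ge0 => d _; rewrite /view /weight4 /=.
(* The root edges do not depend on [u] and [v]. The code read from the last six triples is
   convertible to [flag v]. *)
pose flag u := code (view E v0 (take 6 (drop 4 pattern4)) [:: a; b; c; d; u]).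
have zero : 0 <= \sum_(u : V) \sum_(v : V) (0 : Z).
  by rewrite big1 // => u _; rewrite big1.
case: (_ \in E) => //; case: (_ \in E); case: (_ \in E) => //.
all: case: (_ \in E) => //.
- by apply: (form_psd flag (sq := squares2)).
- by apply: (form_psd flag (sq := squares1)).
Qed.

Lemma sum_weight2_ge0 :
  0 <= \sum_(x : 6.-tuple V) weight2 (view E v0 pattern2 x).
Proof.
rewrite (sum_6tuple (fun x => weight2 (view E v0 pattern2 x))).
apply: sumr_ge0 => a _; apply: sumr_ge0 => b _.
(* A flag over two roots adds an ordered pair, so the four inner sums form a double sum over
   [V * V]. *)
pose flag (uv : V * V) :=
  flag2 (view E v0 (take 4 pattern2) [:: a; b; uv.1; uv.2]).
suff -> : \sum_c \sum_d \sum_u \sum_v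
    weight2 (view E v0 pattern2 [:: a; b; c; d; u; v]) =
    \sum_p \sum_q form squares0 (flag p) (flag q) by apply: form_psd.
rewrite pair_big /=; apply: eq_bigr => p _.
by rewrite pair_big.
Qed.

Lemma sum_weight5 :
  \sum_(x : 6.-tuple V) weight5 (view E v0 pattern5 x) =
  (\sum_(x : 5.-tuple V) weight5 (view E v0 pattern5 x)) *+ #|V|.
Proof.
rewrite (sum_6tuple (fun x => weight5 (view E v0 pattern5 x))).
rewrite (sum_5tuple (fun x => weight5 (view E v0 pattern5 x))).
rewrite -sumrMnl; apply: eq_bigr => a _; rewrite -sumrMnl.
apply: eq_bigr => b _; rewrite -sumrMnl; apply: eq_bigr => c _.
rewrite -sumrMnl; apply: eq_bigr => d _; rewrite -sumrMnl.
by apply: eq_bigr => u _; rewrite -sumr_const; apply: eq_bigr.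
Qed.

Lemma sum_weight5_le : \sum_(x : 5.-tuple V) weight5 (view E v0 pattern5 x) <=
  20 * #|V|%:R ^+ 5.
Proof.
(* [slack_ge0] covers every list of 20 booleans, including those read from non-injective [x]. *)
have : 0 <= \sum_(x : 6.-tuple V) slack (view E v0 triples x).
  by apply: sumr_ge0 => x _; apply: slack_ge0; rewrite size_map.
have slackE g : slack g = scale * (120 - weight_sum weight5 places5 g) -
  (weight_sum weight4 places4 g + weight_sum weight2 places2 g) by [].
under eq_bigr do rewrite slackE.
rewrite sumrB big_split -mulr_sumr /= sumrB /=.
have t5 : \sum_(x : 6.-tuple V)
    weight_sum weight5 places5 (view E v0 triples x) =
    (\sum_(x : 6.-tuple V) weight5 (view E v0 pattern5 x)) *+ 6.
  by rewrite places5E (weight_sum_view _ _ _ reorders5).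
have t4 : \sum_(x : 6.-tuple V)
    weight_sum weight4 places4 (view E v0 triples x) =
    (\sum_(x : 6.-tuple V) weight4 (view E v0 pattern4 x)) *+ 360.
  by rewrite places4E (weight_sum_view _ _ _ reorders4).
have t2 : \sum_(x : 6.-tuple V)
    weight_sum weight2 places2 (view E v0 triples x) =
    (\sum_(x : 6.-tuple V) weight2 (view E v0 pattern2 x)) *+ 45.
  by rewrite places2E (weight_sum_view _ _ _ reorders2).
rewrite t5 t4 t2 sumr_const card_tuple sum_weight5.
apply: cancel_squares => //; first by apply/card_gt0P; exists v0.
  exact: sum_weight4_ge0.
exact: sum_weight2_ge0.
Qed.

End SumsOfSquares.

(** * From tuples to 5-element subsets *)

Section UniqTuples.
Variables (V : finType) (E : {set {set V}}) (v0 : V).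
Hypothesis E3 : is_3graph E.

Lemma setE_card3 (e : {set V}) : e \in E -> #|e| = 3%N.
Proof. by move=> eE; have /forall_inP/(_ _ eE)/eqP := E3. Qed.

Lemma count_view (y : seq V) : uniq y -> size y = 5%N ->
  count id (view E v0 pattern5 y) = #|(E ::&: [set v in y])%SET|.
Proof.
move=> Uy y5; rewrite /view count_map.
pose S (t : seq nat) := [set v in map (nth v0 y) t]%SET.
(* The last clause makes [t] sorted, hence determined by its set of entries; this yields the
   injectivity of [S]. *)
have pat5 t : t \in pattern5 ->
    [/\ all (fun i => i < 5)%N t, uniq t, size t = 3%N
      & t = [seq i <- iota 0 5 | i \in t]].
  have /allP pat : all (fun t => [&& all (fun i => i < 5)%N t, uniq t,
      size t == 3%N & t == [seq i <- iota 0 5 | i \in t]]) pattern5.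
    by vm_compute.
  by move=> /pat /and4P[? ? /eqP ? /eqP ?]; split.
have mem_S t i :
    t \in pattern5 -> (i < 5)%N -> (nth v0 y i \in S t) = (i \in t).
  move=> /pat5[/allP t5 _ _ _] i5; rewrite inE; apply/mapP/idP => [[j jt] |it].
    by move/eqP; rewrite nth_uniq ?y5 ?(t5 _ jt) // => /eqP ->.
  by exists i.
have S_inj : {in pattern5 &, injective S}.
  move=> s t ps pt Sst; have [_ _ _ ->] := pat5 s ps.
  have [_ _ _ ->] := pat5 t pt; apply: eq_in_filter => i.
  by rewrite mem_iota /= => i5; rewrite -!mem_S // Sst.
have US : uniq (map S pattern5) by rewrite map_inj_in_uniq //; vm_compute.
(* One inclusion is enough, since both sides have 10 elements. *)
have draws : [set e in map S pattern5] =
    [set e : {set V} | (e \subset [set v in y]) && (#|e| == 3%N)]%SET.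
  apply/eqP; rewrite eqEcard; apply/andP; split.
    apply/subsetP => e; rewrite in_set => /mapP[t pt ->]; rewrite in_set.
    have [/allP t5 Ut t3 _] := pat5 t pt; apply/andP; split.
      apply/subsetP => v; rewrite !inE => /mapP[i it ->].
      by rewrite mem_nth // y5 t5.
    rewrite cardsE; have /card_uniqP -> : uniq (map (nth v0 y) t).
      rewrite map_inj_in_uniq // => i j it jt /eqP.
      by rewrite nth_uniq ?y5 ?t5 // => /eqP.
    by rewrite size_map t3.
  rewrite cards_draws cardsE (card_uniqP Uy) y5 cardsE (card_uniqP US).
  by rewrite size_map; vm_compute.
rewrite (_ : (E ::&: _)%SET = [set e in map S pattern5 | e \in E]); last first.
  apply/setP => e; rewrite !in_set andbC; apply: andb_id2r => eE.
  by have /setP/(_ e) := draws; rewrite !in_set (setE_card3 eE) eqxx andbT.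
transitivity (count (mem E) (map S pattern5)); first by rewrite count_map.
rewrite -size_filter cardsE -(card_uniqP (filter_uniq (mem E) US)).
by apply: eq_card => e; rewrite mem_filter andbC unfold_in.
Qed.

(** The tuples are partitioned by their sets of entries, each 5-set having 120 orderings. *)
Lemma card_uniq_view (k : nat) :
  #|[set y : 5.-tuple V | uniq y && (count id (view E v0 pattern5 y) == k)]%SET|
  = (120 * e_mk 5 k E)%N.
Proof.
rewrite /e_mk; set A := (X in (120 * #|X|)%N).
rewrite -sum1_card (partition_big (fun y : 5.-tuple V => [set v in y]%SET)
  (fun S => S \in A)); last first.
  move=> y; rewrite in_set => /andP[Uy].
  rewrite count_view ?size_tuple // => yk.
  by rewrite in_set yk andbT cardsE (card_uniqP Uy) size_tuple.
rewrite mulnC -sum_nat_const; apply: eq_bigr => S.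
rewrite in_set => /andP[/eqP S5 Sk].
have <- : (#|S| ^_ 5 = 120)%N by rewrite S5.
rewrite -(card_uniq_tuples 5 (mem S)) sum1_card.
apply: eq_card => y; rewrite unfold_in !in_set andbC.
case Uy: (uniq y); last first.
  by rewrite !andbF.
rewrite andbT andTb count_view ?size_tuple //.
apply/andP/allP => [[/eqP <- _] v vy|yS]; first by rewrite /= inE.
suff -> : [set v in y]%SET = S by [].
apply/eqP; rewrite eqEcard S5 cardsE (card_uniqP Uy) size_tuple leqnn andbT.
by apply/subsetP => v; rewrite inE => /yS.
Qed.

End UniqTuples.

Lemma e54_le (V : finType) (E : {set {set V}}) :
  is_3graph E -> (27 * (120 * e_mk 5 4 E) <= 20 * #|V| ^ 5)%N.
Proof.
(* [view] takes a default vertex, so the empty vertex set is treated apart. *)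
move=> E3; have [V0|/card_gt0P[v0 _]] := posnP #|V|.
  rewrite (_ : e_mk 5 4 E = 0)%N //; apply/eqP; rewrite cards_eq0 -subset0.
  apply/subsetP => S; rewrite in_set => /andP[/eqP S5 _].
  by have := max_card (mem S); rewrite S5 V0.
rewrite -(card_uniq_view v0 E3) -(ler_nat Z) natrM (natrM _ 20) natrX.
apply: le_trans (sum_weight5_le E v0).
(* Tuples with repetitions count 0 on the left and have nonnegative weight on the right. *)
rewrite mulr_natr -sumr_const big_mkcond ler_sum // => y _.
by rewrite in_set /weight5; case: (uniq y); case: (_ == 4%N).
Qed.

(** * Complements exchange 4 and 6 *)

Lemma e_mk_complement (V : finType) (E : {set {set V}}) (k : nat) :
  is_3graph E -> (k <= 10)%N ->
  e_mk 5 k ([set e : {set V} | #|e| == 3%N] :\: E)%SET = e_mk 5 (10 - k) E.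
Proof.
move=> E3 k10; apply: eq_card => S; rewrite !in_set.
apply: andb_id2l => /eqP S5.
set D := (_ :\: E)%SET.
have : (#|E ::&: S| + #|D ::&: S| = 10)%N.
  have <- : #|[set e : {set V} | e \subset S & #|e| == 3%N]%SET| = 10%N.
    by rewrite cards_draws S5.
  rewrite -cardsUI; have -> : ((E ::&: S) :&: (D ::&: S) = set0)%SET.
    by apply/setP => e; rewrite !in_set; case: (e \in E); rewrite ?andbF.
  rewrite cards0 addn0; apply: eq_card => e; rewrite !in_set.
  case eE: (e \in E); rewrite ?(setE_card3 E3 eE) ?andbF ?andbT ?orbF //=.
  by rewrite andbC.
by move: #|_| #|_| k10 => a b; lia.
Qed.

Lemma max_e_mk_complement (k n : nat) : (k <= 10)%N ->
  (max_e_mk 5 k n <= max_e_mk 5 (10 - k) n)%N.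
Proof.
move=> k10; apply/bigmax_leqP => E E3.
have cE3 : is_3graph ([set e : {set 'I_n} | #|e| == 3%N] :\: E)%SET.
  by apply/forall_inP => e; rewrite !in_set => /andP[].
rewrite -{1}(subKn k10) -(e_mk_complement E3 (leq_subr _ _)).
exact: (leq_bigmax_cond _ cE3).
Qed.

Lemma max_e_56 (n : nat) : max_e_mk 5 6 n = max_e_mk 5 4 n.
Proof. by apply/eqP; rewrite eqn_leq !max_e_mk_complement. Qed.

(** * The lower bound: the colouring construction *)

Definition colour (n : nat) (v : 'I_n) : nat := (v %% 3)%N.

(** The edges are the triples whose colours are all equal or all distinct. *)
Definition colour_graph (n : nat) : {set {set 'I_n}} :=
  [set e : {set 'I_n} | (#|e| == 3%N) && (3 %| \sum_(v in e) colour v)%N]%SET.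

Definition balanced (c : seq nat) : bool :=
  count (fun t => 3 %| sumn (map (nth 0 c) t))%N pattern5 == 4%N.

(** These are 180 of the 243 colourings, in proportion 20/27: 30, 60 and 90 with class sizes
    (4,1,0), (3,1,1) and (2,2,1). *)
Definition colourings : seq (seq nat) :=
  [seq c <- iter 5 (fun cs => [seq i :: c | i <- iota 0 3, c <- cs]) [:: [::]] |
     balanced c].

Lemma colour_graph3 (n : nat) : is_3graph (colour_graph n).
Proof. by apply/forall_inP => e; rewrite in_set => /andP[]. Qed.

Lemma view_colour_graph (n : nat) (v0 : 'I_n) (y : seq 'I_n) :
  uniq y -> size y = 5%N ->
  view (colour_graph n) v0 pattern5 y =
  [seq (3 %| sumn (map (nth 0 (map (@colour n) y)) t))%N | t <- pattern5].
Proof.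
move=> Uy y5; apply/eq_in_map => t pt.
have /allP/(_ _ pt)/and3P[/allP t5 Ut /eqP t3] :
    all (fun t => [&& all (fun i => i < 5)%N t, uniq t & size t == 3%N])
      pattern5.
  by vm_compute.
have Uyt : uniq (map (nth v0 y) t).
  rewrite map_inj_in_uniq // => i j it jt /eqP.
  by rewrite nth_uniq ?y5 ?t5 // => /eqP.
rewrite in_set cardsE (card_uniqP Uyt) size_map t3 eqxx andTb.
congr (3 %| _)%N; rewrite (eq_bigl (mem (map (nth v0 y) t))); last first.
  by move=> v; rewrite in_set.
rewrite -big_uniq // sumnE !big_map; apply: eq_big_seq => i it.
by rewrite (nth_map v0) // y5 t5.
Qed.

Lemma card_coloured (n m : nat) (c : seq nat) :
  (3 * m <= n)%N -> (0 < n)%N -> size c = 5%N -> all (fun i => i < 3)%N c ->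
  (m ^_ 5 <=
     #|[set y : 5.-tuple 'I_n | uniq y & map (@colour n) y == c]%SET|)%N.
Proof.
move=> mn n0 c5 /allP c3; pose v0 := Ordinal n0.
(* The vertex [3 * z_i + c_i] has colour [c_i] and is less than [3 * m], so the default [v0] is
   never taken. *)
pose f (z : 5.-tuple 'I_m) : 5.-tuple 'I_n :=
  [tuple insubd v0 (3 * tnth z i + nth 0 c i)%N | i < 5].
have ci3 (i : 'I_5) : (nth 0 c i < 3)%N by apply: c3; rewrite mem_nth // c5.
have fE z i : tnth (f z) i = (3 * tnth z i + nth 0 c i)%N :> nat.
  rewrite tnth_mktuple val_insubd; case: ifP => // /negP[].
  by have := ltn_ord (tnth z i); have := ci3 i; lia.
have f_inj : injective f.
  move=> z z' zz; apply: eq_from_tnth => i; apply: val_inj.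
  by have := fE z i; rewrite zz fE /=; lia.
rewrite -[m in (m ^_ _)%N]card_ord -(card_uniq_tuples 5 (mem 'I_m)).
rewrite -(card_imset _ f_inj); apply: subset_leq_card; apply/subsetP => y.
case/imsetP => z; rewrite in_set => /andP[_ /tuple_uniqP Uz] ->.
rewrite in_set; apply/andP; split.
  apply/tuple_uniqP => i j /(congr1 val); rewrite /= !fE => ij; apply: Uz.
  by apply: val_inj; have := ci3 i; have := ci3 j; move: ij => /=; lia.
apply/eqP; apply: (eq_from_nth (x0 := 0%N)); rewrite size_map size_tuple ?c5 //.
move=> i i5; rewrite (nth_map v0) ?size_tuple //.
rewrite -[i]/(val (Ordinal i5)) -(tnth_nth v0) /colour fE.
by have := ci3 (Ordinal i5) => /=; lia.
Qed.

(** [card_coloured] is summed over the 180 colourings; a tuple has a single colouring, so it is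
    counted at most once. *)
Lemma max_e54_ge (n m : nat) : (3 * m <= n)%N ->
  (180 * m ^_ 5 <= 120 * max_e_mk 5 4 n)%N.
Proof.
move=> mn; have [n0|n_gt0] := posnP n.
  by move: mn; rewrite n0 leqn0 muln_eq0 /= => /eqP ->.
pose v0 := Ordinal n_gt0.
apply: (@leq_trans (120 * e_mk 5 4 (colour_graph n))); last first.
  by rewrite leq_mul2l /=; apply: leq_bigmax_cond; apply: colour_graph3.
rewrite -(card_uniq_view v0 (colour_graph3 n)).
have cs c : c \in colourings ->
    [/\ size c = 5%N, all (fun i => i < 3)%N c & balanced c].
  have /allP ok : all (fun c => [&& size c == 5%N, all (fun i => i < 3)%N c
      & balanced c]) colourings by vm_compute.
  by move=> /ok /and3P[/eqP].
have Ucs : uniq colourings by vm_compute.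
have <- : size colourings = 180%N by vm_compute.
move: colourings cs Ucs => G cs Ucs.
apply: (@leq_trans (\sum_(c <- G)
  #|[set y : 5.-tuple 'I_n | uniq y & map (@colour n) y == c]%SET|)).
  rewrite -sum1_size big_distrl /= !big_seq leq_sum // => c /cs[c5 c3 _].
  by rewrite mul1n card_coloured.
under eq_bigr do rewrite -sum1_card big_mkcond.
rewrite exchange_big -sum1_card [X in (_ <= X)%N]big_mkcond leq_sum // => y _.
under eq_bigr do rewrite in_set.
rewrite in_set; case Uy: (uniq y); last by rewrite big1.
have [yc|yc] := boolP (map (@colour n) y \in G); last first.
  rewrite big_seq big1 // => c cc; case: eqP => // yE.
  by rewrite yE cc in yc.
have -> : count id (view (colour_graph n) v0 pattern5 y) == 4%N.
  by have [_ _] := cs _ yc; rewrite view_colour_graph ?size_tuple // count_map.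
rewrite (bigD1_seq _ yc Ucs) /= eqxx big1 // => c.
by rewrite eq_sym => /negPf ->.
Qed.

(** * Passage to the limit *)

Lemma ffact5_bounds (n : nat) : ((n - 4) ^ 5 <= n ^_ 5 <= n ^ 5)%N.
Proof.
rewrite !ffactnS ffactn0 !expnS expn0.
by apply/andP; split; rewrite !leq_mul //; lia.
Qed.

Lemma density54_bounds (R : realType) (n : nat) : (14 < n)%N ->
  20 / 27 * (1 - 14 * (n%:R : R)^-1) ^+ 5 <= density_mk R 5 4 n <=
  20 / 27 * (1 - 4 * (n%:R : R)^-1)^-1 ^+ 5.
Proof.
move=> n14; rewrite /density_mk; set M := max_e_mk 5 4 n.
have n_gt0 : (0 < n)%N by lia.
have n0 : (0 : R) < n%:R by rewrite ltr0n.
have n4 : (0 : R) < n%:R - 4.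
  by rewrite subr_gt0 -[4]/(4%:R) ltr_nat; lia.
have n14R : (0 : R) < n%:R - 14.
  by rewrite subr_gt0 -[14]/(14%:R) ltr_nat.
have /andP[lo hi] := ffact5_bounds n.
have C120 : (120 : R) * 'C(n, 5)%:R = (n ^_ 5)%:R.
  by rewrite -bin_ffact natrM mulrC.
have C0 : (0 : R) < 'C(n, 5)%:R by rewrite ltr0n bin_gt0; lia.
have loR : ((n%:R : R) - 4) ^+ 5 <= 120 * 'C(n, 5)%:R.
  rewrite C120 -[4]/(4%:R) -natrB ?(ltnW (leq_trans _ n14)) //.
  by rewrite -natrX ler_nat.
have hiR : (120 : R) * 'C(n, 5)%:R <= n%:R ^+ 5.
  by rewrite C120 -natrX ler_nat.
have upM : (27 * 120 : R) * M%:R <= 20 * n%:R ^+ 5.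
  rewrite -natrX -!natrM ler_nat /M /max_e_mk.
  elim/big_ind: _ => [|x y|E E3]; rewrite ?muln0 //.
    by rewrite /maxn; case: ifP.
  by rewrite -mulnA -[n in (n ^ 5)%N]card_ord; apply: e54_le.
(* For [m = n %/ 3], [3 * m >= n - 2] gives [m - 4 >= (n - 14) / 3]. The constant comes out as 180 /
   3^5 = 20/27 after the factor 120 cancels. *)
have loM : 180 * (((n%:R : R) - 14) / 3) ^+ 5 <= 120 * M%:R.
  have m3 : (3 * (n %/ 3) <= n)%N by lia.
  have /andP[m4 _] := ffact5_bounds (n %/ 3).
  have := leq_trans (leq_mul (leqnn 180) m4) (max_e54_ge m3).
  rewrite -(ler_nat R) natrM (natrM _ 120) natrX; apply: le_trans.
  rewrite ler_pM2l ?ltr0n // lerXn2r ?nnegrE ?divr_ge0 ?ler0n ?(ltW n14R) //.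
  rewrite ler_pdivrMr ?ltr0n // lerBlDr -natrM -natrD ler_nat; lia.
have x0 : (n%:R : R) != 0 by rewrite gt_eqF.
have x4 : (n%:R : R) - 4 != 0 by rewrite gt_eqF.
rewrite (_ : 1 - 14 * _ = (n%:R - 14) / n%:R :> R); last by field.
rewrite (_ : (1 - 4 * _)^-1 = n%:R / (n%:R - 4) :> R); last first.
  by field; rewrite x4.
rewrite ler_pdivlMr // ler_pdivrMr // !expr_div_n; apply/andP; split.
  apply: (@le_trans _ _ (20 / 27 * (n%:R - 14) ^+ 5 / 120)); last first.
    by rewrite expr_div_n in loM; lra.
  rewrite -!mulrA !ler_pM2l ?invr_gt0 ?ltr0n ?exprn_gt0 //.
  rewrite mulrC ler_pdivrMr ?exprn_gt0 // mulrC ler_pdivlMr ?ltr0n //.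
  by rewrite mulrC.
apply: (@le_trans _ _ (20 / 27 * n%:R ^+ 5 / 120)); first by lra.
rewrite -!mulrA !ler_pM2l ?invr_gt0 ?ltr0n // ?exprn_gt0 //.
rewrite [leRHS]mulrC ler_pdivlMr ?exprn_gt0 // mulrC ler_pdivrMr ?ltr0n //.
by rewrite mulrC.
Qed.

Lemma density54_cvg (R : realType) :
  (density_mk R 5 4 @ \oo --> (20 / 27 : R))%classic.
Proof.
have lin (c : R) : (1 - c * harmonic n @[n --> \oo] --> (1 : R))%classic.
  rewrite -[X in (_ --> X)%classic]subr0 -(mulr0 c).
  by apply: cvgB; [exact: cvg_cst | apply: cvgM; [exact: cvg_cst |
    exact: cvg_harmonic]].
have pow5 (u : nat -> R) : (u @ \oo --> (1 : R))%classic ->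
    (20 / 27 * u n ^+ 5 @[n --> \oo] --> (20 / 27 : R))%classic.
  move=> u1; rewrite -[X in (_ --> X)%classic]mulr1 -(expr1n _ 5).
  apply: cvgM; first exact: cvg_cst.
  apply: (@continuous_cvg _ _ _ _ _ _ (fun x : R => x ^+ 5)) => //.
  exact: exprn_continuous.
(* [harmonic n] is 1 / (n + 1), hence the shift by one. *)
rewrite -cvg_shiftS.
apply: (@squeeze_cvgr _ _ _ _ (fun n => 20 / 27 * (1 - 14 * harmonic n) ^+ 5)
  (fun n => 20 / 27 * (1 - 4 * harmonic n)^-1 ^+ 5)).
- near=> n; apply: density54_bounds; rewrite ltnS; near: n.
  exact: nbhs_infty_ge.
- exact: pow5 (lin 14).
- apply: pow5; rewrite -[X in (_ --> X)%classic]invr1.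
  by apply: cvgV (lin 4); rewrite oner_eq0.
Unshelve. all: by end_near.
Qed.

Theorem theorem2p29 (R : realType) :
  pi_mk R 5 4 = 20 / 27 /\ pi_mk R 5 6 = 20 / 27.
Proof.
have pi54 : pi_mk R 5 4 = 20 / 27 by apply: cvg_lim (@density54_cvg R).
split=> //; rewrite -pi54 /pi_mk; congr (lim (_ @ \oo)%classic).
by apply/funext => n; rewrite /density_mk max_e_56.
Qed.
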